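(* Let $\mathcal{H}=\{\chi_{[0,t]} : t\in[0,1]\}\subset L^2([0,1])$. Then $$\frac{1}{4\sqrt n}\le W_n(\mathcal{H})\quad (n\ge1),\qquad W_n(\mathcal{H})\le\frac{2}{\pi\sqrt{n-1}}\quad(n\ge2),$$ and $$N(\varepsilon,\mathcal{H})\asymp\Big(\frac1\varepsilon\Big)^2,\qquad H_l(\varepsilon,\mathcal{H})\asymp\Big(\frac1\varepsilon\Big)^2\log\Big(\frac1\varepsilon\Big).$$
   Context: $\chi_E$ denotes the characteristic function of $E$. For a subset $A$ of a Banach space $V$, the Kolmogorov $n$-width is $$W_n(A)=\inf_{\dim L=n}\ \sup_{x\in A}\ \mathrm{dist}(x,L),$$ the infimum being over all $n$-dimensional linear subspaces $L$ of $V$, and $\mathrm{dist}(x,L)$ being the distance from $x$ to $L$; here $V=L^2([0,1])$. $N(\varepsilon,A)$ is the minimal $n$ for which $W_n(A)\le\varepsilon$. The linear $\varepsilon$-entropy of $A$ is $H_l(\varepsilon,A)=N(\varepsilon,A)\log(1/\varepsilon)$, where $\log$ is the binary logarithm. The notation $f(\varepsilon)\asymp g(\varepsilon)$ means that there are constants $C_1,C_2>0$ with $C_1g(\varepsilon)\le f(\varepsilon)\le C_2g(\varepsilon)$ for all sufficiently small $\varepsilon>0$. *)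

(* Defs.v *)
From HB Require Import structures.
From mathcomp Require Import all_boot all_order all_algebra.
From mathcomp Require Import all_classical all_reals all_analysis.
From mathcomp Require Import measurable_realfun ess_sup_inf.

Set Implicit Arguments.
Unset Strict Implicit.
Unset Printing Implicit Defensive.
Import Order.TTheory GRing.Theory Num.Theory.
Import numFieldNormedType.Exports.

Local Open Scope classical_set_scope.
Local Open Scope ring_scope.

Lemma filterS4 T (F : set_system T) {FF : Filter F} (P1 P2 P3 P4 Q : set T) :
  (forall x, P1 x -> P2 x -> P3 x -> P4 x -> Q x) ->
  F P1 -> F P2 -> F P3 -> F P4 -> F Q.
Proof.
move=> h F1 F2 F3; apply: filterS2 (filterI F1 (filterI F2 F3)) => x.
by move=> [? [? ?]]; exact: h.
Qed.

Lemma filterS5 T (F : set_system T) {FF : Filter F} (P1 P2 P3 P4 P5 Q : set T) :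
  (forall x, P1 x -> P2 x -> P3 x -> P4 x -> P5 x -> Q x) ->
  F P1 -> F P2 -> F P3 -> F P4 -> F P5 -> F Q.
Proof.
move=> h F1 F2 F3 F4; apply: filterS2 (filterI F1 (filterI F2 (filterI F3 F4))).
by move=> x [? [? [? ?]]]; exact: h.
Qed.

(* The library's [LspaceType mu p1] is the type of classes modulo mu-a.e.
   equality of functions with finite p-norm, but it carries no algebraic
   structure; it is turned here into a normed space over R. *)
Section Lspace_normed.
Context d (T : measurableType d) (R : realType).
Variables (mu : {measure set T -> \bar R}) (p : \bar R) (p1 : (1 <= p)%E).

Local Notation Lp := (LspaceType mu p1).
Local Notation Lf := (LfunType mu p1).

Lemma Lnorm_ae0 (f : T -> R) : measurable_fun setT f ->
  f = (cst 0 : T -> R) %[ae mu] -> ('N[mu]_p[EFin \o f] = 0)%E.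
Proof.
move=> mf f0; rewrite unlock /Lnorm; case: p p1 => [r| |] //= r1.
- have r0 : r != 0 by rewrite gt_eqF// (lt_le_trans ltr01).
  rewrite (_ : (\int[mu]_x _ = 0)%E); first by rewrite poweR0r// invr_eq0.
  rewrite -[RHS](integral0 mu setT); apply: ae_eq_integral => //.
    have mF : measurable_fun setT (fun x => `|(f x)%:E|%E).
      by apply: measurableT_comp => //; exact/measurable_EFinP.
    exact: (measurableT_comp (measurable_poweR r) mF).
  apply: filterS f0 => x /(_ I) /= -> _.
  by rewrite normr0 powR0.
- case: ifPn => // mu0; apply: ess_sup_ae_cst => //.
  by apply: filterS f0 => x /(_ I) /= ->; rewrite normr0.
Qed.

Lemma le_Lnorm_ae (f g : T -> R) : measurable_fun setT f ->
  measurable_fun setT g -> f = g %[ae mu] ->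
  ('N[mu]_p[EFin \o f] <= 'N[mu]_p[EFin \o g])%E.
Proof.
move=> mf mg fg.
have -> : f = g \+ (f \- g) by apply/funext => x /=; rewrite addrC subrK.
have mfg : measurable_fun setT (f \- g) by exact: measurable_funB.
apply: (le_trans (eminkowski _ mg mfg p1)).
rewrite (Lnorm_ae0 mfg) ?adde0//.
by apply: filterS fg => x /(_ I) /= ->; rewrite subrr.
Qed.

Lemma eq_Lnorm_ae (f g : T -> R) : measurable_fun setT f ->
  measurable_fun setT g -> f = g %[ae mu] ->
  ('N[mu]_p[EFin \o f] = 'N[mu]_p[EFin \o g])%E.
Proof.
move=> mf mg fg; apply/eqP; rewrite eq_le !le_Lnorm_ae//.
by apply: filterS fg => x /[apply].
Qed.

Lemma Lspace_mem (u : Lp) : (u : T -> R) \in Lfun mu p.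
Proof.
apply/andP; split; rewrite inE /=; last exact: Lebesgue_finite.
exact: (@measurable_funPT _ _ _ _ (repr (u : {mfun_ mu, T >-> measurableTypeR R}))).
Qed.

Lemma LfunP_mfun (f : Lf) :
  (f : T -> measurableTypeR R) \in @mfun _ _ T (measurableTypeR R).
Proof. by rewrite inE; exact: (@measurable_funPT _ _ _ _ f). Qed.

Definition Lrepr (u : Lp) : Lf := Lfun_Sub p1 (Lspace_mem u).

Local Notation mquot := {mfun_ mu, T >-> measurableTypeR R}.

Section Lclass.
Variable f : Lf.

Let fm : {mfun T >-> measurableTypeR R} := mfun_Sub (LfunP_mfun f).
Let q : mquot := (\pi_mquot fm)%qT.

Let qE : (q : T -> R) = f %[ae mu].
Proof. by apply/asboolP; have /eqP := reprK q; rewrite eqmodE. Qed.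

Let qfin : finite_norm mu p q.
Proof.
rewrite /finite_norm (eq_Lnorm_ae _ _ qE); first exact: Lfunction_finite.
  exact: (@measurable_funPT _ _ _ _ (repr q)).
exact: (@measurable_funPT _ _ _ _ f).
Qed.

Definition Lclass : Lp :=
  HB.pack_for Lp q (isFinLebesgue.Build d T R mu p p1 q qfin).

Lemma LclassE : (Lclass : T -> R) = f %[ae mu]. Proof. exact: qE. Qed.

End Lclass.

Lemma Lspace_eqP (u v : Lp) : u = v <-> (u : T -> R) = v %[ae mu].
Proof.
split=> [-> //|]; first exact: (ae_eq_refl mu setT).
case: u => u cu; case: v => v cv /= uv.
have {}uv : u = v by rewrite -[u]reprK -[v]reprK; apply/eqP; rewrite eqmodE; exact/asboolP.
rewrite -uv in cv *.
case: cu cv => [[a]] [[b]].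
by rewrite (Prop_irrelevance a b).
Qed.

HB.instance Definition _ := gen_eqMixin Lp.
HB.instance Definition _ := gen_choiceMixin Lp.

Definition Ladd (u v : Lp) : Lp := Lclass (Lrepr u + Lrepr v).
Definition Lopp (u : Lp) : Lp := Lclass (- Lrepr u).
Definition Lzero : Lp := Lclass 0.
Definition Lscale (a : R) (u : Lp) : Lp := Lclass (a *: Lrepr u).

Lemma LaddE u v : (Ladd u v : T -> R) = (u : T -> R) \+ v %[ae mu].
Proof. exact: LclassE. Qed.
Lemma LoppE u : (Lopp u : T -> R) = \- (u : T -> R) %[ae mu].
Proof. exact: LclassE. Qed.
Lemma LzeroE : (Lzero : T -> R) = (cst 0 : T -> R) %[ae mu].
Proof. exact: LclassE. Qed.
Lemma LscaleE a u : (Lscale a u : T -> R) = a \*: (u : T -> R) %[ae mu].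
Proof. exact: LclassE. Qed.

Let LaddA : associative Ladd.
Proof.
move=> u v w; apply/Lspace_eqP.
have := LaddE u (Ladd v w); have := LaddE v w.
have := LaddE (Ladd u v) w; have := LaddE u v.
apply: filterS4 => x /(_ I) h1 /(_ I) h2 /(_ I) h3 /(_ I) h4 _.
by rewrite h4 h2 /= h1 h3 /= addrA.
Qed.

Let LaddC : commutative Ladd.
Proof.
move=> u v; apply/Lspace_eqP.
have := LaddE u v; have := LaddE v u.
by apply: filterS2 => x /(_ I) h1 /(_ I) h2 _; rewrite h1 h2 /= addrC.
Qed.

Let Ladd0 : left_id Lzero Ladd.
Proof.
move=> u; apply/Lspace_eqP; have := LaddE Lzero u; have := LzeroE.
by apply: filterS2 => x /(_ I) h1 /(_ I) h2 _; rewrite h2 /= h1 add0r.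
Qed.

Let LaddN : left_inverse Lzero Lopp Ladd.
Proof.
move=> u; apply/Lspace_eqP.
have := LaddE (Lopp u) u; have := LoppE u; have := LzeroE.
apply: filterS3 => x /(_ I) h1 /(_ I) h2 /(_ I) h3 _.
by rewrite h3 h1 /= h2 /= addNr.
Qed.

HB.instance Definition _ := GRing.isZmodule.Build Lp LaddA LaddC Ladd0 LaddN.

Let LscaleA a b u : Lscale a (Lscale b u) = Lscale (a * b) u.
Proof.
apply/Lspace_eqP.
have := LscaleE a (Lscale b u); have := LscaleE b u; have := LscaleE (a * b) u.
apply: filterS3 => x /(_ I) h1 /(_ I) h2 /(_ I) h3 _.
by rewrite h3 h1 /= h2 /= scalerA.
Qed.

Let Lscale1 : left_id 1 Lscale.
Proof.
move=> u; apply/Lspace_eqP; have := LscaleE 1 u.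
by apply: filterS => x /(_ I) h1 _; rewrite h1 /= scale1r.
Qed.

Let LscaleDr : right_distributive Lscale +%R.
Proof.
move=> a u v; apply/Lspace_eqP.
have := LscaleE a (u + v); have := LaddE u v.
have := LaddE (Lscale a u) (Lscale a v).
have := LscaleE a u; have := LscaleE a v.
apply: filterS5 => x /(_ I) h1 /(_ I) h2 /(_ I) h3 /(_ I) h4 /(_ I) h5 _.
by rewrite h5 h3 /= h4 h1 h2 /= scalerDr.
Qed.

Let LscaleDl u : {morph Lscale^~ u : a b / a + b}.
Proof.
move=> a b; apply/Lspace_eqP.
have := LscaleE (a + b) u; have := LaddE (Lscale a u) (Lscale b u).
have := LscaleE a u; have := LscaleE b u.
apply: filterS4 => x /(_ I) h1 /(_ I) h2 /(_ I) h3 /(_ I) h4 _.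
by rewrite h4 h3 /= h1 h2 /= scalerDl.
Qed.

HB.instance Definition _ := GRing.Zmodule_isLmodule.Build R Lp
  LscaleA Lscale1 LscaleDr LscaleDl.

Definition Lp_norm (u : Lp) : R := fine ('N[mu]_p[EFin \o (u : T -> R)])%E.

Lemma Lp_normE (f : Lf) : Lp_norm (Lclass f) = fine ('N[mu]_p[EFin \o f])%E.
Proof.
congr fine; apply: eq_Lnorm_ae; last exact: LclassE.
  exact: (@measurable_funPT _ _ _ _ (Lrepr (Lclass f))).
exact: (@measurable_funPT _ _ _ _ f).
Qed.

Let Lp_normD u v : Lp_norm (u + v) <= Lp_norm u + Lp_norm v.
Proof. by rewrite Lp_normE; exact: ler_LnormD. Qed.

Let Lp_normZ a u : Lp_norm (a *: u) = `|a| * Lp_norm u.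
Proof.
rewrite Lp_normE; apply: EFin_inj.
by rewrite finite_norm_fine EFinM /Lp_norm (finite_norm_fine (Lrepr u)) -LnormZ.
Qed.

Let Lp_norm0 u : Lp_norm u = 0 -> u = 0.
Proof.
move=> /(fine_Lnormr_eq0 (f := Lrepr u)) u0; apply/Lspace_eqP.
have := LzeroE; move: u0.
by apply: filterS2 => x /(_ I) h1 /(_ I) h2 _; rewrite h2; exact: h1.
Qed.

HB.instance Definition _ := Lmodule_isNormed.Build R Lp
  Lp_normD Lp_normZ Lp_norm0.

End Lspace_normed.

Definition log2 (R : realType) (x : R) : R := ln x / ln 2.

Definition asymp_small (R : realType) (f g : R -> R) :=
  exists C1 C2 : R, [/\ 0 < C1, 0 < C2 &
    \forall e \near 0^'+, C1 * g e <= f e /\ f e <= C2 * g e].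

Section widths.
Context (R : realType) (V : normedModType R).

Definition lin_indep n (b : 'I_n -> V) :=
  forall c : 'I_n -> R, \sum_(i < n) c i *: b i = 0 -> forall i, c i = 0.

Definition lin_span n (b : 'I_n -> V) : set V :=
  [set \sum_(i < n) c i *: b i | c in [set: 'I_n -> R]].

Definition has_dim (n : nat) (L : set V) :=
  exists2 b : 'I_n -> V, lin_indep b & L = lin_span b.

Definition edist_to (L : set V) (x : V) : \bar R :=
  ereal_inf [set `|x - y|%:E | y in L].

Definition width (n : nat) (A : set V) : \bar R :=
  ereal_inf [set ereal_sup [set edist_to L x | x in A] | L in has_dim n].

(* Takes the junk value 0 when no n satisfies [width n A <= e]; since
   [width 0 A] is the supremum of the norms on A, the value 0 is otherwise
   attained only when A lies in the closed ball of radius e. *)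
Definition widthN (e : R) (A : set V) : nat :=
  xget 0%N [set n | (width n A <= e%:E)%E /\
                    forall m, (width m A <= e%:E)%E -> (n <= m)%N].

Definition lin_entropy (e : R) (A : set V) : R :=
  (widthN e A)%:R * log2 (1 / e).

End widths.

Section L2_unit_interval.
Context (R : realType).

Local Notation leb := (@lebesgue_measure R).

Lemma itv01_fin : (leb `[0%R, 1%R] < +oo)%E.
Proof. by rewrite lebesgue_measure_itv/= lte01 oppr0 adde0 ltry. Qed.

(* Lebesgue measure on [0, 1], as a measure on R which ignores the complement
   of [0, 1]; functions on R modulo a.e. equality for this measure are the same
   thing as functions on [0, 1] modulo a.e. equality. *)
Definition leb01 : {finite_measure set (measurableTypeR R) -> \bar R} :=
  @mfrestr _ (measurableTypeR R) R `[0, 1] leb (measurable_itv _) itv01_fin.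

Definition L2_01 : normedModType R := LspaceType2 leb01.

Lemma chi_Lfun (t : R) : (\1_(`[0, t]) : R -> R) \in Lfun leb01 2%:E.
Proof.
apply/andP; split; rewrite inE /=.
  by apply: measurable_indic; exact: measurable_itv.
rewrite /finite_norm unlock /Lnorm; apply: poweR_lty.
rewrite (@eq_integral _ (measurableTypeR R) R leb01 setT
  (fun x => (\1_(`[0, t]) x)%:E)); last first.
  by move=> x _ /=; rewrite indicE; case: (_ \in _) => /=;
    rewrite ?normr1 ?normr0 ?powR1 ?powR0.
rewrite integral_indic// setIT ltey_eq fin_num_measure//.
Qed.

Definition chi (t : R) : L2_01 := Lclass (Lfun_Sub (lee1n 2) (chi_Lfun t)).

Definition initial_indicators : set L2_01 := [set chi t | t in `[0, 1]].

End L2_unit_interval.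

(* Main.v *)
Require Import Defs.
From mathcomp Require Import all_boot all_order all_algebra.
From mathcomp Require Import all_classical all_reals all_analysis.
From mathcomp Require Import measurable_realfun.
From mathcomp Require Import ring lra zify.
Set Implicit Arguments.
Unset Strict Implicit.
Unset Printing Implicit Defensive.
Import Order.TTheory GRing.Theory Num.Theory.
Import numFieldNormedType.Exports.
Local Open Scope classical_set_scope.
Local Open Scope ring_scope.

(** Everything is read off from the increments
    e_k = chi((k+1)/N) - chi(k/N), k < N, of the curve t |-> chi(t).  They are
    orthogonal in L^2 with squared norm 1/N, and ip (chi s) (chi t) = min s t.

    Upper bound.  The squared distance from chi(t) to the span of the n
    increments of the grid of mesh 1/n is, by [pythagoras], t minus n times the
    sum of the squares of p_j = ip (chi t) (e_j).  As the p_j add up to t, this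
    is the sum of the p_j (1 - n p_j); only the cell containing t contributes,
    and it contributes at most 1/(4n).  So W_n <= 1/(2 sqrt n), which is stronger
    than the bound claimed because pi < 4.

    Lower bound.  If W_n < w, each chi(k/N) is within w of some n-dimensional
    space L, hence each e_k is within 2w of some z_k in L.  Let C be the N x N
    matrix of the coordinates of the z_k on the e_j; its rank is at most n, and
    [bessel] bounds the Frobenius norm of I - C by the distances from e_k to
    z_k.  A matrix of rank at most n lies at squared Frobenius distance at least
    N - n from the identity ([frob_sq_1B_ge]), whence N - n < (2 N w)^2.  Taking
    N = 2n gives W_n >= 1/(4 sqrt n); taking N = 1 gives W_0 >= 1/2.

    For 0 < w < 1/2 the two bounds place N(w) between 1/(16 w^2) and 1/w^2, and
    the estimate of the linear entropy follows on multiplying by log2 (1/w). *)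

(** * Distance from the identity to matrices of small rank *)

Section matrix_approximation.
Context {R : realFieldType}.

(** The squared Frobenius norm. *)
Definition frob_sq m n (A : 'M[R]_(m, n)) : R := \sum_i \sum_j A i j ^+ 2.

Lemma frob_sqE m n (A : 'M[R]_(m, n)) : frob_sq A = \tr (A *m A^T).
Proof.
by apply: eq_bigr => i _; rewrite mxE; apply: eq_bigr => j _; rewrite mxE expr2.
Qed.

Lemma frob_sq_ge0 m n (A : 'M[R]_(m, n)) : 0 <= frob_sq A.
Proof. by apply: sumr_ge0 => i _; apply: sumr_ge0 => j _; rewrite sqr_ge0. Qed.

Lemma frob_sq_eq0 m n (A : 'M[R]_(m, n)) : frob_sq A = 0 -> A = 0.
Proof.
move=> /eqP; rewrite psumr_eq0; last first.
  by move=> i _; apply: sumr_ge0 => j _; rewrite sqr_ge0.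
move=> /allP h; apply/matrixP => i j; rewrite mxE.
have := h i (mem_index_enum _); rewrite psumr_eq0; last by move=> *; rewrite sqr_ge0.
by move=> /allP /(_ j (mem_index_enum _)); rewrite sqrf_eq0 => /eqP.
Qed.

Lemma gram_unitmx m n (K : 'M[R]_(m, n)) : row_free K -> K *m K^T \in unitmx.
Proof.
move=> fK; rewrite -row_free_unit; apply/inj_row_free => v vG.
have : frob_sq (v *m K) = 0.
  by rewrite frob_sqE trmx_mul mulmxA -(mulmxA v) vG mul0mx mxtrace0.
move=> /frob_sq_eq0 vK; apply: (row_free_inj fK); by rewrite vK mul0mx.
Qed.

(** The orthogonal projection onto the left kernel of C, which is
    K^T (K K^T)^-1 K for any matrix K whose rows form a basis of that kernel. *)
Lemma exists_orthogonal_annihilator n (C : 'M[R]_n) :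
  exists Q : 'M[R]_n, [/\ Q^T = Q, Q *m Q = Q, Q *m C = 0 &
    \tr Q = (n - \rank C)%N%:R].
Proof.
have [m [K [fK KC mE]]] : exists m (K : 'M[R]_(m, n)),
    [/\ row_free K, K *m C = 0 & m = (n - \rank C)%N].
  exists (\rank (kermx C)), (row_base (kermx C)); split.
  - exact: row_base_free.
  - by apply/sub_kermxP; rewrite eq_row_base.
  - exact: mxrank_ker.
have := gram_unitmx fK; set G := K *m K^T => GU.
have GT : (invmx G)^T = invmx G by rewrite trmx_inv trmx_mul trmxK.
exists (K^T *m invmx G *m K); split.
- by rewrite !trmx_mul trmxK GT mulmxA.
- by rewrite !mulmxA -(mulmxA _ K K^T) -/G -(mulmxA _ (invmx G) G) mulVmx// mulmx1.
- by rewrite -mulmxA KC mulmx0.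
- by rewrite -mulmxA mxtrace_mulC -mulmxA -/G mulVmx// mxtrace1 mE.
Qed.

(** The difference of the two sides is the squared norm of (1 - Q) A. *)
Lemma frob_sq_proj n (Q A : 'M[R]_n) : Q^T = Q -> Q *m Q = Q ->
  frob_sq (Q *m A) <= frob_sq A.
Proof.
move=> QT QQ; rewrite -subr_ge0.
suff -> : frob_sq A - frob_sq (Q *m A) = frob_sq ((1%:M - Q) *m A).
  exact: frob_sq_ge0.
rewrite !frob_sqE !trmx_mul linearB/= trmx1 QT.
rewrite -!mulmxA ![\tr ((_ - _) *m _)]mxtrace_mulC -!mulmxA.
rewrite mulmxBr mulmx1 mulmxBl mul1mx QQ subrr subr0 mulmxBr mulmx1.
rewrite mulmxBr linearB/=; congr (_ - _).
by rewrite mxtrace_mulC -!mulmxA QQ.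
Qed.

(** The projection Q annihilating C sends I - C to Q itself, whose squared norm
    is its trace; and applying Q does not increase the norm. *)
Lemma frob_sq_1B_ge n (C : 'M[R]_n) :
  n%:R - (\rank C)%:R <= frob_sq (1%:M - C).
Proof.
have [Q [QT QQ QC trQ]] := exists_orthogonal_annihilator C.
apply: le_trans (frob_sq_proj _ QT QQ).
by rewrite mulmxBr mulmx1 QC subr0 frob_sqE QT QQ trQ natrB// rank_leq_row.
Qed.

End matrix_approximation.

(** * The inner product of L^2 *)

Section L2_inner_product.
Context d (T : measurableType d) (R : realType).
Variable mu : {measure set T -> \bar R}.

Local Notation L2 := (LspaceType2 mu).

(** The inner product, a plain function of two classes; the integrals are taken
    on chosen representatives, so that its linearity is an almost everywhere
    argument. *)
Definition ip (u v : L2) : R := \int[mu]_x ((u : T -> R) x * (v : T -> R) x).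

Lemma measurable_L2 (u : L2) : measurable_fun setT (u : T -> R).
Proof. exact: (@measurable_funPT _ _ _ _ (Lrepr u)). Qed.

Lemma measurable_L2M (u v : L2) :
  measurable_fun setT (fun x => (u : T -> R) x * (v : T -> R) x).
Proof. by apply: measurable_funM; exact: measurable_L2. Qed.

Lemma integrable_L2M (u v : L2) :
  mu.-integrable setT (EFin \o (fun x => (u : T -> R) x * (v : T -> R) x)).
Proof.
by apply/Lfun1_integrable; apply: Lfun2_mul_Lfun1; exact: Lspace_mem.
Qed.

Lemma eq_Rintegral_ae (f g : T -> R) : measurable_fun setT f ->
  measurable_fun setT g -> f = g %[ae mu] ->
  \int[mu]_x f x = \int[mu]_x g x.
Proof.
move=> mf mg fg; congr fine; apply: ae_eq_integral => //.
- exact/measurable_EFinP.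
- exact/measurable_EFinP.
- by apply: filterS fg => x /(_ I) /= -> _.
Qed.

Lemma ipC u v : ip u v = ip v u.
Proof. by apply: eq_Rintegral => x _; rewrite mulrC. Qed.

Lemma ipDl u v w : ip (u + v) w = ip u w + ip v w.
Proof.
rewrite /ip -RintegralD//; [|exact: integrable_L2M..].
apply: eq_Rintegral_ae.
- exact: measurable_L2M.
- by apply: measurable_funD; exact: measurable_L2M.
- have := LaddE u v; apply: filterS => x /(_ I) /= h _.
  by rewrite -mulrDl -h.
Qed.

Lemma ipZl a u w : ip (a *: u) w = a * ip u w.
Proof.
rewrite /ip -RintegralZl//; last exact: integrable_L2M.
apply: eq_Rintegral_ae.
- exact: measurable_L2M.
- by apply: measurable_funM => //; exact: measurable_L2M.
- have := LscaleE a u; apply: filterS => x /(_ I) /= h _.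
  by rewrite mulrA -[a * _]/(a *: _) -h.
Qed.

Lemma ip_normE u : ip u u = `|u| ^+ 2.
Proof.
have h : (('N[mu]_2%:E[EFin \o (u : T -> R)]) `^ 2 =
    (\int[mu]_x ((u : T -> R) x * (u : T -> R) x))%:E)%E.
  rewrite powR_Lnorm// /Rintegral fineK; last first.
    by apply: integrable_fin_num => //; exact: integrable_L2M.
  apply: eq_integral => x _ /=.
  by rewrite powR_mulrn// -normrX ger0_norm ?sqr_ge0// expr2.
move: h; rewrite -(finite_norm_fine (Lrepr u)) poweR_EFin powR_mulrn ?fine_ge0//.
  by move=> [h]; rewrite /ip -h.
exact: Lnorm_ge0.
Qed.

End L2_inner_product.

(** * Orthogonal families *)

Section L2_orthogonal_families.
Context d (T : measurableType d) (R : realType).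
Variable mu : {measure set T -> \bar R}.

Local Notation L2 := (LspaceType2 mu).

Lemma ipBl (u v w : L2) : ip (u - v) w = ip u w - ip v w.
Proof. by rewrite ipDl -scaleN1r ipZl mulN1r. Qed.

Lemma ip_suml n (c : 'I_n -> R) (u : 'I_n -> L2) (w : L2) :
  ip (\sum_i c i *: u i) w = \sum_i c i * ip (u i) w.
Proof.
have ip0 : ip (0 : L2) w = 0 by rewrite -(scale0r (0 : L2)) ipZl mul0r.
rewrite (big_morph (fun u => ip u w) (fun u v => ipDl u v w) ip0).
by apply: eq_bigr => i _; rewrite ipZl.
Qed.

Variables (N : nat) (a : R) (e : 'I_N -> L2).
Hypotheses (a0 : 0 < a) (e_orth : forall i j, ip (e i) (e j) = a *+ (i == j)).

Lemma ip_sum_orthogonal (c : 'I_N -> R) j :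
  ip (\sum_i c i *: e i) (e j) = a * c j.
Proof.
rewrite ip_suml (bigD1 j)//= e_orth eqxx mulr1n big1 ?addr0 1?mulrC// => i ij.
by rewrite e_orth (negPf ij) mulr0n mulr0.
Qed.

Lemma orthogonal_lin_indep : lin_indep e.
Proof.
move=> c c0 j; have := ip_sum_orthogonal c j.
rewrite c0 -(scale0r (0 : L2)) ipZl mul0r => /esym/eqP.
by rewrite mulf_eq0 gt_eqF//= => /eqP.
Qed.

(** The squared distance from x to its orthogonal projection on the span of
    the family. *)
Lemma pythagoras (x : L2) :
  `|x - \sum_j (ip x (e j) / a) *: e j| ^+ 2 =
  `|x| ^+ 2 - a^-1 * \sum_j ip x (e j) ^+ 2.
Proof.
set p := \sum_j _.
have px : ip p x = a^-1 * \sum_j ip x (e j) ^+ 2.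
  rewrite ip_suml mulr_sumr; apply: eq_bigr => j _; rewrite (ipC (e j)).
  by rewrite expr2 mulrA (mulrC a^-1).
have pp : ip p p = a^-1 * \sum_j ip x (e j) ^+ 2.
  rewrite {1}/p ip_suml mulr_sumr; apply: eq_bigr => j _.
  rewrite (ipC (e j)) ip_sum_orthogonal; field.
  by rewrite gt_eqF.
rewrite -!ip_normE ipBl [ip x (x - p)]ipC [ip p (x - p)]ipC !ipBl.
by rewrite [ip x p]ipC pp px subrr subr0.
Qed.

Lemma bessel (x : L2) : a^-1 * \sum_j ip x (e j) ^+ 2 <= `|x| ^+ 2.
Proof. by rewrite -subr_ge0 -pythagoras exprn_ge0. Qed.

(** A space of dimension at most n cannot approximate well all the vectors of
    an orthogonal family of N > n vectors of equal norm. *)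
Lemma orthogonal_span_approx n (b : 'I_n -> L2) (z : 'I_N -> L2) (r : R) :
  (0 < N)%N -> (forall k, lin_span b (z k)) ->
  (forall k, `|e k - z k| < r) -> a * (N%:R - n%:R) < N%:R * r ^+ 2.
Proof.
move=> N0 bz zr.
have /choice[c cz] : forall k, exists c, \sum_i c i *: b i = z k.
  by move=> k; have [c _ <-] := bz k; exists c.
(* row k of C lists the coordinates on the family of the projection of z k *)
pose C := \matrix_(k < N, j < N) (a^-1 * ip (z k) (e j)).
have rC : (\rank C <= n)%N.
  have -> : C = (\matrix_(k, i) c k i) *m (\matrix_(i, j) (a^-1 * ip (b i) (e j))).
    apply/matrixP => k j; rewrite !mxE -cz ip_suml mulr_sumr.
    by apply: eq_bigr => i _; rewrite !mxE mulrCA.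
  exact: leq_trans (mxrankM_maxl _ _) (rank_leq_col _).
have rowE k : a * \sum_j (1%:M - C) k j ^+ 2 < r ^+ 2.
  have := bessel (e k - z k).
  have -> : a^-1 * \sum_j ip (e k - z k) (e j) ^+ 2 = a * \sum_j (1%:M - C) k j ^+ 2.
    rewrite !mulr_sumr; apply: eq_bigr => j _.
    rewrite ipBl e_orth !mxE -mulr_natr; field.
    by rewrite gt_eqF.
  move=> /le_lt_trans; apply.
  by rewrite ltr_pXn2r ?nnegrE//; exact: ltW (le_lt_trans _ (zr k)).
apply: (@le_lt_trans _ _ (a * frob_sq (1%:M - C))).
  rewrite ler_pM2l//; apply: le_trans (frob_sq_1B_ge C).
  by rewrite lerD2l lerN2 ler_nat.
rewrite /frob_sq mulr_sumr.
have -> : N%:R * r ^+ 2 = \sum_(k < N) r ^+ 2.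
  by rewrite sumr_const card_ord mulr_natl.
apply: ltr_sum => [|k _]; last exact: rowE.
by apply/hasP; exists (Ordinal N0).
Qed.

End L2_orthogonal_families.

(** * Widths *)

Section width_facts.
Context (R : realType) (V : normedModType R).

Lemma width_lt n (A : set V) (w : R) : (width n A < w%:E)%E ->
  exists2 b : 'I_n -> V, lin_indep b &
    forall x, A x -> exists2 y, lin_span b y & `|x - y| < w.
Proof.
move=> /ereal_inf_lt[_ [L [b bi ->] <-]] h; exists b => // x Ax.
have /ereal_inf_lt[_ [y Ly <-]] : (edist_to (lin_span b) x < w%:E)%E.
  by apply: le_lt_trans h; apply: ereal_sup_ubound; exists x.
by rewrite lte_fin; exists y.
Qed.

Lemma width_le n (A : set V) (w : R) (b : 'I_n -> V) : lin_indep b ->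
  (forall x, A x -> exists2 y, lin_span b y & `|x - y| <= w) ->
  (width n A <= w%:E)%E.
Proof.
move=> bi h; apply: ge_ereal_inf; exists (ereal_sup [set edist_to (lin_span b) x | x in A]).
  by exists (lin_span b) => //; exists b.
apply: ge_ereal_sup => _ [x Ax <-]; have [y Ly xy] := h x Ax.
by apply: ge_ereal_inf; exists `|x - y|%:E; [exists y|rewrite lee_fin].
Qed.

End width_facts.

Section widthN_facts.
Context (R : realType) (V : normedModType R).

(** Once some width is at most w, [widthN] is a genuine minimum rather than the
    default value 0. *)
Lemma widthNP (w : R) (A : set V) :
  (exists n, (width n A <= w%:E)%E) ->
  (width (widthN w A) A <= w%:E)%E /\
  forall m, (width m A <= w%:E)%E -> (widthN w A <= m)%N.
Proof.
move=> [n nw]; rewrite /widthN.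
have ex : exists n, (width n A <= w%:E)%E by exists n.
have [m mw mmin] := ex_minnP ex.
have : exists k, [set n | (width n A <= w%:E)%E /\
    forall m, (width m A <= w%:E)%E -> (n <= m)%N] k by exists m.
by move=> /(xgetPex 0%N).
Qed.

End widthN_facts.

(** * Increments of the curve of initial indicators *)

Section initial_indicators.
Context {R : realType}.

Lemma ip_chi (s t : R) : 0 <= s <= 1 -> 0 <= t <= 1 ->
  ip (chi s) (chi t) = Num.min s t.
Proof.
move=> /andP[s0 s1] /andP[t0 t1].
have m01 : 0 <= Num.min s t <= 1 by rewrite le_min s0 t0 ge_min s1.
have -> : ip (chi s) (chi t) = \int[leb01 R]_x \1_(`[0, Num.min s t]) x.
  apply: eq_Rintegral_ae.
  - exact: measurable_L2M.
  - by apply: measurable_indic; exact: measurable_itv.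
  have := LclassE (Lfun_Sub (lee1n 2) (chi_Lfun s)).
  have := LclassE (Lfun_Sub (lee1n 2) (chi_Lfun t)).
  apply: filterS2 => x /(_ I) ht /(_ I) hs _.
  rewrite [chi s x]hs [chi t x]ht /= !indicE -natrM mulnb.
  congr (nat_of_bool _)%:R; rewrite !mem_setE/= !in_itv/= le_min.
  by case: (0 <= x).
rewrite /Rintegral integral_indic//.
rewrite setIT /= /mfrestr /mrestr setIidl; last first.
  move=> x /=; rewrite !in_itv/= => /andP[-> h] /=.
  by apply: (le_trans h); case/andP: m01.
rewrite lebesgue_measure_itv/= lte_fin; case: ltP => // h.
  by rewrite -EFinD/= subr0.
by apply/eqP; rewrite eq_le h; case/andP: m01 => ->.
Qed.

(** The class of the indicator of the interval ]k/N, (k+1)/N]. *)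
Definition step N (k : 'I_N) : L2_01 R := chi (k.+1%:R / N%:R) - chi (k%:R / N%:R).

Lemma grid01 N k : (0 < N)%N -> (k <= N)%N -> 0 <= (k%:R / N%:R : R) <= 1.
Proof.
move=> N0 kN; rewrite divr_ge0//= ler_pdivrMr ?ltr0n//.
by rewrite mul1r ler_nat.
Qed.

Lemma ip_chi_step N (t : R) (k : 'I_N) : 0 <= t <= 1 ->
  ip (chi t) (step k) = Num.min t (k.+1%:R / N%:R) - Num.min t (k%:R / N%:R).
Proof.
move=> t01; have N0 : (0 < N)%N by apply: leq_ltn_trans (ltn_ord k).
rewrite ipC ipBl !(ipC _ (chi t)) !ip_chi//; apply: grid01 => //.
exact: ltnW.
Qed.

Lemma step_orthogonal N (i j : 'I_N) : ip (step i) (step j) = N%:R^-1 *+ (i == j).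
Proof.
have N0 : (0 < N)%N by apply: leq_ltn_trans (ltn_ord i).
have minE (k l : nat) : Num.min (k%:R / N%:R) (l%:R / N%:R) = (minn k l)%:R / N%:R :> R.
  by rewrite -minr_pMl ?invr_ge0// -natr_min.
rewrite ipBl !ip_chi_step ?grid01//; last exact: ltnW.
rewrite !minE -!mulrBl -[RHS]mulr_natl; congr (_ * _).
have /(congr1 (fun k => k%:R : R)) : (minn i.+1 j.+1 + minn i j =
    (i == j) + minn i.+1 j + minn i j.+1)%N.
  by rewrite -val_eqE /=; lia.
by rewrite !natrD => h; lra.
Qed.

(** Each step is a difference of two elements of the set, so it is within 2 w of
    an n-dimensional space, to which [orthogonal_span_approx] applies. *)
Lemma lt_width_initial_indicators (n N : nat) (w : R) : (0 < N)%N ->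
  (width n (@initial_indicators R) < w%:E)%E -> N%:R - n%:R < (2 * N%:R * w) ^+ 2.
Proof.
move=> N0 /width_lt[b _ h].
have N0' : 0 < N%:R :> R by rewrite ltr0n.
have {}h k : (k <= N)%N -> exists2 y, lin_span b y & `|chi (k%:R / N%:R) - y| < w.
  by move=> kN; apply: h; exists (k%:R / N%:R) => //=; rewrite in_itv/= grid01.
have : forall k : 'I_N, exists z, lin_span b z /\ `|step k - z| < 2 * w.
  move=> k; have [_ [cy _ <-] yw] := h _ (ltn_ord k).
  have [_ [cz _ <-] zw] := h _ (ltnW (ltn_ord k)).
  exists (\sum_i cy i *: b i - \sum_i cz i *: b i); split.
    exists (fun i => cy i - cz i) => //.
    by rewrite -sumrB; apply: eq_bigr => i _; rewrite scalerBl.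
  set y := \sum_i _ in yw *; set z := \sum_i _ in zw *.
  have -> : step k - (y - z) =
      (chi (k.+1%:R / N%:R) - y) - (chi (k%:R / N%:R) - z).
    by rewrite /step !opprB addrACA [in RHS]addrACA [- y - _]addrC.
  by rewrite (le_lt_trans (ler_normB _ _))// (_ : 2 * w = w + w) ?ltrD//; ring.
move=> /choice[z zP].
have := @orthogonal_span_approx _ _ _ _ N _ (@step N) _ (@step_orthogonal N) n b z (2 * w) N0.
rewrite invr_gt0 N0' => /(_ isT) /(_ (fun k => proj1 (zP k))) /(_ (fun k => proj2 (zP k))).
rewrite mulrC ltr_pdivrMr// => /lt_le_trans; apply.
by rewrite le_eqVlt; apply/orP; left; apply/eqP; ring.
Qed.

Lemma width_initial_indicators_ge n : (0 < n)%N ->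
  ((1 / (4 * Num.sqrt n%:R))%:E <= width n (@initial_indicators R))%E.
Proof.
move=> n0; rewrite leNgt; apply/negP.
(* N = 2n makes (N - n) / (2N)^2 largest *)
move=> /(@lt_width_initial_indicators n (2 * n)).
rewrite muln_gt0 n0 => /(_ isT).
have n0' : 0 < n%:R :> R by rewrite ltr0n.
rewrite exprMn expr_div_n expr1n [(4 * _) ^+ 2]exprMn sqr_sqrtr ?ler0n// natrM.
rewrite [X in _ < X](_ : _ = n%:R); last by field; rewrite gt_eqF.
by lra.
Qed.

Lemma width0_initial_indicators_ge :
  ((1 / 2)%:E <= width 0 (@initial_indicators R))%E.
Proof.
rewrite leNgt; apply/negP => /(@lt_width_initial_indicators 0 1 _ isT); lra.
Qed.

(** The left-hand side is the squared distance from chi t to the span of the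
    n steps. *)
Lemma step_defect_le n (t : R) : (0 < n)%N -> 0 <= t <= 1 ->
  t - n%:R * \sum_(j < n) ip (chi t) (step j) ^+ 2 <= (4 * n%:R)^-1.
Proof.
move=> n0 t01; have n0' : 0 < n%:R :> R by rewrite ltr0n.
pose p (j : 'I_n) := ip (chi t) (step j).
have pE j : p j = Num.min t (j.+1%:R / n%:R) - Num.min t (j%:R / n%:R).
  exact: ip_chi_step.
have tE : t = \sum_(j < n) p j.
  under eq_bigr do rewrite pE.
  rewrite -(big_mkord xpredT (fun j => Num.min t (j.+1%:R / n%:R) - Num.min t (j%:R / n%:R))).
  rewrite telescope_sumr// mul0r divff ?gt_eqF//.
  by case/andP: t01 => t0 t1; rewrite (min_idPl t1) (min_idPr t0) subr0.
rewrite [X in X - _]tE mulr_sumr -sumrB.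
have p0 (j : 'I_n) : ~~ (j%:R / n%:R < t < j.+1%:R / n%:R) -> p j - n%:R * p j ^+ 2 = 0.
  have jj : j%:R / n%:R <= j.+1%:R / n%:R :> R by rewrite ler_pM2r ?invr_gt0// ler_nat.
  rewrite pE negb_and -!leNgt => /orP[tj|jt].
    by rewrite !(min_idPl _) ?subrr ?mulr0 ?subr0 ?expr0n ?mulr0 ?subr0// (le_trans tj).
  rewrite (min_idPr jt) (min_idPr (le_trans jj jt)) -mulrBl -natrB// subSnn; field.
  by rewrite gt_eqF.
(* only a cell having t in its interior contributes, and there is at most one *)
have [/existsP[k /andP[kt tk]]|/existsPn none] :=
    boolP [exists j : 'I_n, j%:R / n%:R < t < j.+1%:R / n%:R]; last first.
  by rewrite big1 ?invr_ge0 ?mulr_ge0// => j _; exact/p0/none.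
rewrite (bigD1 k)//= big1 ?addr0; last first.
  move=> j jk; apply: p0; apply/negP => /andP[jt tj].
  move: (lt_trans kt tj) (lt_trans jt tk).
  rewrite !ltr_pM2r ?invr_gt0// !ltr_nat !ltnS => kj kj'.
  by move: jk; rewrite -val_eqE/= eqn_leq kj kj'.
rewrite -/(p k) -subr_ge0.
rewrite (_ : _ - _ = n%:R * (p k - (2 * n%:R)^-1) ^+ 2); last first.
  by field; rewrite gt_eqF.
by rewrite mulr_ge0 ?sqr_ge0// ltW.
Qed.

Lemma width_initial_indicators_le n : (0 < n)%N ->
  (width n (@initial_indicators R) <= (1 / (2 * Num.sqrt n%:R))%:E)%E.
Proof.
move=> n0; have n0' : 0 < n%:R :> R by rewrite ltr0n.
have a0 : 0 < n%:R^-1 :> R by rewrite invr_gt0.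
apply: (@width_le _ _ _ _ _ (@step n)).
  exact: (orthogonal_lin_indep a0 (@step_orthogonal n)).
move=> _ [t t01 <-]; rewrite /= in_itv/= in t01.
exists (\sum_(j < n) (ip (chi t) (step j) / n%:R^-1) *: step j).
  by eexists.
rewrite -(@ler_pXn2r _ 2)// ?nnegrE ?divr_ge0 ?mulr_ge0 ?sqrtr_ge0//.
rewrite (pythagoras a0 (@step_orthogonal n)) -ip_normE ip_chi// minxx invrK.
apply: (le_trans (step_defect_le n0 t01)).
rewrite expr_div_n exprMn expr1n sqr_sqrtr ?ler0n// div1r.
by rewrite -natrX.
Qed.

Lemma widthN_initial_indicators (w : R) : 0 < w < 1 / 2 ->
  16^-1 * (1 / w) ^+ 2 <= (widthN w (@initial_indicators R))%:R <= (1 / w) ^+ 2.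
Proof.
move=> /andP[w0 w2].
set H := @initial_indicators R.
(* the least n for which 1 / (2 sqrt n) < w *)
set n := (Num.truncn ((4 * w ^+ 2)^-1)).+1.
have w24 : 0 < 4 * w ^+ 2 by rewrite mulr_gt0 ?exprn_gt0.
have /andP[n1 n2] : n.-1%:R <= (4 * w ^+ 2)^-1 < n%:R.
  by apply: truncn_itv; rewrite invr_ge0 ltW.
have n0' : 0 < n%:R :> R by rewrite ltr0n.
have wn : (width n H <= w%:E)%E.
  apply: le_trans (width_initial_indicators_le _) _ => //.
  rewrite lee_fin ler_pdivrMr ?mulr_gt0 ?sqrtr_gt0//.
  rewrite -(@ler_pXn2r _ 2)// ?nnegrE ?mulr_ge0 ?sqrtr_ge0 ?(ltW w0)//.
  rewrite !exprMn sqr_sqrtr ?(ltW n0')// expr1n.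
  move: n2; rewrite -div1r ltr_pdivrMr// => /ltW n2.
  by rewrite (_ : _ * _ = n%:R * (4 * w ^+ 2))//; ring.
have [Nw Nmin] := @widthNP _ _ w H (ex_intro _ n wn).
apply/andP; split; last first.
  apply: (@le_trans _ _ n%:R); first by rewrite ler_nat; exact: Nmin.
  have v2 : 2 < 1 / w by rewrite ltr_pdivlMr// mulrC -ltr_pdivlMr.
  have -> : n%:R = n.-1%:R + 1 :> R by rewrite natr1.
  have vE : (4 * w ^+ 2)^-1 = (1 / w) ^+ 2 / 4 by field; rewrite gt_eqF.
  move: n1 v2; rewrite vE; move: (1 / w) (n.-1%:R) => v k; clear=> kv v2.
  by nra.
(* the lower bound on W_n needs n > 0, and W_0 is excluded separately *)
have N0 : (0 < widthN w H)%N.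
  rewrite lt0n; apply/eqP => N0; rewrite N0 in Nw.
  have := le_trans width0_initial_indicators_ge Nw.
  by rewrite lee_fin leNgt w2.
have := le_trans (width_initial_indicators_ge N0) Nw.
rewrite lee_fin; set m := widthN w H => h.
have m0 : 0 < m%:R :> R by rewrite ltr0n.
have {}h : 1 <= w ^+ 2 * (4 ^+ 2 * m%:R).
  move: h; rewrite ler_pdivrMr ?mulr_gt0 ?sqrtr_gt0//.
  rewrite -[X in is_true X -> _](@ler_pXn2r _ 2)// ?nnegrE ?mulr_ge0 ?sqrtr_ge0 ?(ltW w0)//.
  by rewrite !exprMn sqr_sqrtr ?(ltW m0)// expr1n.
rewrite expr_div_n expr1n mulrA mulr1 ler_pdivrMr ?exprn_gt0//.
by move: (w ^+ 2) (m%:R) h => x y h; clear -h; lra.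
Qed.

End initial_indicators.

Theorem theorem2p10 (R : realType) :
  let H := @initial_indicators R in
  [/\ forall n : nat, (1 <= n)%N ->
        ((1 / (4 * Num.sqrt n%:R))%:E <= width n H)%E,
      forall n : nat, (2 <= n)%N ->
        (width n H <= (2 / (pi * Num.sqrt (n%:R - 1)))%:E)%E,
      asymp_small (fun e : R => (widthN e H)%:R) (fun e => (1 / e) ^+ 2) &
      asymp_small (fun e : R => lin_entropy e H)
                  (fun e => (1 / e) ^+ 2 * log2 (1 / e))].
Proof.
move=> H; split.
- exact: width_initial_indicators_ge.
- move=> n n2; apply: le_trans (width_initial_indicators_le _) _; first exact: ltnW.
  have n1 : 0 < n%:R - 1 :> R by rewrite subr_gt0 ltr1n.
  rewrite lee_fin.
  have pi4 : pi < 4 :> R by have := @pihalf_lt2 R; lra.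
  have s1 : 0 < Num.sqrt (n%:R - 1) :> R by rewrite sqrtr_gt0.
  have s2 : Num.sqrt (n%:R - 1) <= Num.sqrt n%:R :> R by rewrite ler_sqrt//; lra.
  have p0 := @pi_gt0 R.
  rewrite ler_pdivrMr ?mulr_gt0//; last by lra.
  rewrite mulrAC ler_pdivlMr ?mulr_gt0// mul1r.
  apply: (@le_trans _ _ (4 * Num.sqrt (n%:R - 1))); last by lra.
  by rewrite ler_pM2r// ltW.
- exists 16^-1, 1; split => //; near=> e.
  apply/andP; rewrite [1 * _ ^+ 2]mul1r; apply: widthN_initial_indicators.
  by apply/andP; split; near: e; [exact: nbhs_right_gt|exact: nbhs_right_lt].
- exists 16^-1, 1; split => //; near=> e.
  have e02 : 0 < e < 1 / 2.
    by apply/andP; split; near: e; [exact: nbhs_right_gt|exact: nbhs_right_lt].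
  have l0 : 0 <= log2 (1 / e).
    case/andP: e02 => e0 e2; rewrite /log2 divr_ge0// ln_ge0 ?ler1n//.
    by rewrite ler_pdivlMr//; lra.
  have /andP[h1 h2] := widthN_initial_indicators e02.
  by rewrite /lin_entropy [1 * (_ * _)]mul1r mulrA !ler_wpM2r.
Unshelve. all: by end_near. Qed.
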